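(* Let $R$ be a commutative ring and let $f(x)\in R[[x]]$ be a solution of an isolating equation $$f(x)=\sum_{i=1}^dA_i(x)\Phi^i(f(x))+g(x),$$ where $A_i(x)\in R[x]$, $\Phi$ is the Z-Mahler operator, and $g(x)\in R[[x]]$ is Z-regular. Then $f$ is also Z-regular.
   Context: Zeckendorf numeration: let $F_{-2}=0$, $F_{-1}=1$, $F_n=F_{n-1}+F_{n-2}$ for $n\geq 0$. Every $n\in\mathbb{N}$ has a unique expansion $n=\sum_{i=0}^k b_iF_i$ with $b_i\in\{0,1\}$, no two consecutive digits $1$ and no leading zeros; $(n)_Z=b_k\cdots b_0$. Define $\phi(\sum_i b_iF_i)=\sum_i b_iF_{i+1}$ where $(n)_Z=b_k\cdots b_0$, and $\Phi:R[[x]]\to R[[x]]$, $\Phi(\sum f_nx^n)=\sum f_nx^{\phi(n)}$. Weighted automaton: $\mathcal{A}=(S,B,\Delta,I,F)$ with $S$ a finite set, $I,F:S\to R$ and $\Delta:S\times B\times S\to R$. A path labelled $b_1\cdots b_n$ through $s_0,\dots,s_n$ has weight $I(s_0)\prod_i\Delta(s_{i-1},b_i,s_i)F(s_n)$. $\mathrm{weight}_{\mathcal{A}}(w)$ is the sum of the weights of all paths labelled $w$. A series $f=\sum f_nx^n$ is Z-regular if there is a weighted automaton with $B=\{0,1\}$ such that $f_n=\mathrm{weight}_{\mathcal{A}}((n)_Z)$ for all $n\ge0$, with $(n)_Z$ read from the most significant digit. *)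

(* Defs.v *)
From HB Require Import structures.
From mathcomp Require Import all_boot all_order all_algebra.
Set Implicit Arguments.
Unset Strict Implicit.
Unset Printing Implicit Defensive.

Import GRing.Theory.

Fixpoint fib (n : nat) : nat :=
  match n with
  | 0 => 0
  | 1 => 1
  | (n'.+1 as n1).+1 => fib n1 + fib n'
  end.

(* F_i for i >= 0, in the indexing F_{-2} = 0, F_{-1} = 1 (so F_0 = 1,        *)
(* F_1 = 2): F_i is the usual Fibonacci number of index i + 2.                *)
Definition zF (i : nat) : nat := fib i.+2.

(* Digit words b_k ... b_0 are written most significant digit first, with     *)
(* true for the digit 1; [digit w i] is b_i.                                  *)
Definition digit (w : seq bool) (i : nat) : bool := nth false (rev w) i.

Definition zval (w : seq bool) : nat := \sum_(i < size w) digit w i * zF i.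

Definition nonadj (a b : bool) : bool := ~~ (a && b).

(* No two consecutive digits 1, and no leading 0. The only such word of value *)
(* 0 is the empty word.                                                       *)
Definition canonical (w : seq bool) : bool :=
  sorted nonadj w && head true w.

Definition is_zeckendorf (n : nat) (w : seq bool) : bool :=
  canonical w && (zval w == n).

Lemma zFSS i : zF i.+2 = zF i.+1 + zF i.
Proof. by []. Qed.

Lemma zF_gt i : i < zF i.
Proof.
suff [] : i < zF i /\ i.+1 < zF i.+1 by [].
elim: i => [//|i [IH1 IH2]]; split=> //.
rewrite zFSS; apply: leq_ltn_trans (_ : zF i.+1 + 0 < _); first by rewrite addn0.
by rewrite ltn_add2l (leq_ltn_trans _ IH1).
Qed.

Lemma zF_leS i : zF i <= zF i.+1.
Proof. by case: i => [//|i]; rewrite zFSS leq_addr. Qed.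

Lemma zF_homo : {homo zF : i j / i <= j}.
Proof. exact: homo_leq leqnn leq_trans zF_leS. Qed.

Lemma zval_nil : zval [::] = 0.
Proof. by rewrite /zval big_ord0. Qed.

Lemma zval_cons b w : zval (b :: w) = b * zF (size w) + zval w.
Proof.
rewrite /zval /= big_ord_recr /= addnC /digit rev_cons; congr (_ + _).
  by rewrite nth_rcons size_rev ltnn eqxx.
by apply: eq_bigr => i _; rewrite nth_rcons size_rev ltn_ord.
Qed.

Lemma sorted_false w : sorted nonadj (false :: w) = sorted nonadj w.
Proof. by case: w. Qed.

Lemma zval_lt w : sorted nonadj w -> zval w < zF (size w).
Proof.
have [n] := ubnP (size w); elim: n w => [//|n IH] [|[] w] szw sw.
- by rewrite zval_nil.
- case: w szw sw => [|[] w] // szw; first by rewrite zval_cons zval_nil.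
  rewrite -[sorted _ _]/(sorted nonadj (false :: w)) sorted_false => sw.
  rewrite !zval_cons mul1n mul0n add0n zFSS ltn_add2l.
  exact: IH (ltnW szw) sw.
rewrite zval_cons mul0n add0n; move: sw; rewrite sorted_false => sw.
exact: leq_trans (IH _ szw sw) (zF_leS _).
Qed.

Lemma zval_padded k n : n < zF k ->
  exists w, [/\ size w = k, sorted nonadj w & zval w = n].
Proof.
have [m] := ubnP k; elim: m k n => [//|m IH] [|[|k]] n km.
- by case: n => // _; exists [::]; rewrite zval_nil.
- by case: n => [|[|]] // _; [exists [:: false] | exists [:: true]];
    rewrite zval_cons zval_nil.
have [nk _|kn] := ltnP n (zF k.+1).
  have [w [sz sw vw]] := IH k.+1 n km nk.
  by exists (false :: w); rewrite sorted_false zval_cons /= sz vw.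
rewrite zFSS -{1}(subnKC kn) ltn_add2l => nk.
have [w [sz sw vw]] := IH k _ (ltnW km) nk.
exists [:: true, false & w]; split; first by rewrite /= sz.
  by rewrite -[sorted _ _]/(sorted nonadj (false :: w)) sorted_false.
by rewrite !zval_cons /= sz vw mul1n mul0n add0n subnKC.
Qed.

Lemma zeckendorf_exists n : exists w, is_zeckendorf n w.
Proof.
have [w [_ sw vw]] := zval_padded (zF_gt n).
elim: w sw vw => [|[] w IH] sw vw.
- by exists [::]; rewrite /is_zeckendorf vw eqxx.
- by exists (true :: w); rewrite /is_zeckendorf /canonical vw eqxx sw.
by apply: IH; [move: sw; rewrite sorted_false | rewrite -vw zval_cons].
Qed.

Lemma zval_inj_size w1 w2 : size w1 = size w2 ->
  sorted nonadj w1 -> sorted nonadj w2 -> zval w1 = zval w2 -> w1 = w2.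
Proof.
elim: w1 w2 => [|b1 w1 IH] [|b2 w2] //= [sz] s1 s2.
have {}s1 := path_sorted s1; have {}s2 := path_sorted s2.
rewrite !zval_cons sz; have := zval_lt s1; have := zval_lt s2; rewrite sz.
case: b1 b2 => [] [] l2 l1; rewrite ?mul1n ?mul0n ?add0n.
- by move/addnI => e; rewrite (IH w2).
- by move=> e; move: l2; rewrite -e ltnNge leq_addr.
- by move=> e; move: l1; rewrite e ltnNge leq_addr.
by move=> e; rewrite (IH w2).
Qed.

Lemma canonical_size w1 w2 : canonical w1 -> canonical w2 ->
  zval w1 = zval w2 -> size w1 <= size w2.
Proof.
case: w1 => [//|b1 w1] /andP[_ /= b1P] /andP[s2 _] e.
rewrite ltnNge; apply: contraTN (zval_lt s2) => le.
by rewrite -leqNgt -e zval_cons b1P mul1n (leq_trans (zF_homo le)) ?leq_addr.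
Qed.

Lemma zeckendorf_unique n w1 w2 :
  is_zeckendorf n w1 -> is_zeckendorf n w2 -> w1 = w2.
Proof.
move=> /andP[c1 /eqP v1] /andP[c2 /eqP v2].
have e : zval w1 = zval w2 by rewrite v1 v2.
apply: zval_inj_size => //; [|by case/andP: c1|by case/andP: c2].
by apply/eqP; rewrite eqn_leq !canonical_size.
Qed.

(* (n)_Z *)
Definition zeck (n : nat) : seq bool := xchoose (zeckendorf_exists n).

Lemma zeckP n : is_zeckendorf n (zeck n).
Proof. exact: xchooseP. Qed.

Lemma zeck_zval w : canonical w -> zeck (zval w) = w.
Proof.
by move=> cw; apply: zeckendorf_unique (zeckP _) _; rewrite /is_zeckendorf cw /=.
Qed.

Definition phi (n : nat) : nat :=
  \sum_(i < size (zeck n)) digit (zeck n) i * zF i.+1.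

Lemma phi_ge n : n <= phi n.
Proof.
have /andP[_ /eqP {1}<-] := zeckP n.
by apply: leq_sum => i _; rewrite leq_mul2l zF_leS orbT.
Qed.

Local Open Scope ring_scope.

(* R[[x]]: f stands for the series \sum_n f n x^n. The base ring may be the   *)
(* zero ring, which {poly R} does not allow; R[x] is therefore taken inside   *)
(* R[[x]], as the series with finitely many nonzero coefficients.             *)
Definition series (R : Type) : Type := nat -> R.

Definition is_polynomial (R : comPzRingType) (a : series R) : Prop :=
  exists N : nat, forall n : nat, (N <= n)%N -> a n = 0.

Definition series_mul (R : comPzRingType) (a b : series R) : series R :=
  fun n => \sum_(i < n.+1) a i * b (n - i)%N.

(* Since n <= phi n, every n with phi n = m occurs in the sum below.          *)
Definition Phi (R : comPzRingType) (f : series R) : series R :=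
  fun m => \sum_(n < m.+1 | phi n == m) f n.

Record weighted_automaton (R : Type) (B : Type) := WeightedAutomaton {
  state : finType;
  wtrans : state -> B -> state -> R;
  winit : state -> R;
  wfinal : state -> R
}.

(* p lists the states s_0, ..., s_n of a path labelled by the n letters of w. *)
Definition path_weight (R : comPzRingType) (B : Type)
    (A : weighted_automaton R B) (w : seq B)
    (p : {ffun 'I_(size w).+1 -> state A}) : R :=
  winit (p ord0)
  * (\prod_(i < size w)
       wtrans (p (widen_ord (leqnSn _) i)) (tnth (in_tuple w) i)
              (p (lift ord0 i)))
  * wfinal (p ord_max).

Definition weight (R : comPzRingType) (B : Type)
    (A : weighted_automaton R B) (w : seq B) : R :=
  \sum_(p : {ffun 'I_(size w).+1 -> state A}) path_weight p.

Definition Z_regular (R : comPzRingType) (f : series R) : Prop :=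
  exists A : weighted_automaton R bool, forall n : nat, f n = weight A (zeck n).

(* Main.v *)
(* With beta n the last Zeckendorf digit of n, one has phi (n + 1) = phi n + 2
   - beta n, and every n is uniquely phi k + beta n with k not ending in 1 if
   beta n = 1. If n = phi v + b and c is small, then n - c = phi (v - c') + a,
   where c' and a depend only on b, c and the window beta v, ..., beta (v - C),
   and so does the window of n. Two consecutive gaps of phi add up to at least
   3, so c' is roughly at most 2c / 3: if the degrees of the A_i are below L and
   C = 2L + 2, then c <= C + L gives c' <= C. Hence the values at v - c
   (0 <= c <= C) of the series Phi^i f and of the state vectors of an automaton
   for g form a finite vector, which evolves linearly, with coefficients
   depending on the window, when a digit is appended to the expansion of v: the
   equation expresses f (n - c) by the (Phi^i f) (n - c - l) with i >= 1, l < L,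
   and (Phi^i f) (phi k + a) is (Phi^(i-1) f) k or 0. *)
Require Import Defs.
From mathcomp Require Import all_boot all_order all_algebra.
From mathcomp Require Import zify.
Set Implicit Arguments.
Unset Strict Implicit.
Unset Printing Implicit Defensive.
Import GRing.Theory.

(** * Appending a digit to an expansion, and [phi] *)

Lemma zval_rcons w b : zval (rcons w b) = zval (rcons w false) + b.
Proof.
rewrite /zval !size_rcons !big_ord_recl /digit !rev_rcons /= mul0n add0n addnC.
by rewrite (_ : zF 0 = 1) ?muln1.
Qed.

Lemma zval_rcons_false w :
  zval (rcons w false) = \sum_(i < size w) digit w i * zF i.+1.
Proof.
rewrite /zval size_rcons big_ord_recl /digit rev_rcons /= mul0n.
by apply: eq_bigr => i _.
Qed.

Lemma zval_rcons_false2 w :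
  zval (rcons (rcons w false) false) = zval (rcons w false) + zval w.
Proof.
rewrite !zval_rcons_false size_rcons big_ord_recl /digit rev_rcons /= mul0n.
rewrite /zval -big_split; apply: eq_bigr => i _ /=.
by rewrite -mulnDr; congr (_ * _); rewrite /bump /= add1n.
Qed.

Lemma sorted_nonadj_rcons w b :
  sorted nonadj (rcons w b) = sorted nonadj w && nonadj (last false w) b.
Proof. by case: w => [|a w] //=; rewrite rcons_path. Qed.

(* The last digit of [(n)_Z], with 0 for the empty expansion of 0. *)
Definition lastd (n : nat) : bool := last false (zeck n).

Lemma zval_zeck n : zval (zeck n) = n.
Proof. by have /andP[_ /eqP] := zeckP n. Qed.

Lemma zeck_canonical n : canonical (zeck n).
Proof. by have /andP[] := zeckP n. Qed.

Lemma zeck_sorted n : sorted nonadj (zeck n).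
Proof. by have /andP[] := zeck_canonical n. Qed.

(** Leading zeros contribute nothing to either side, so induction strips them until [w] is
    canonical. *)
Lemma phiE w : sorted nonadj w -> phi (zval w) = zval (rcons w false).
Proof.
elim: w => [|[] w IH] sw.
- by rewrite /phi (@zeck_zval [::]) // big_ord0 zval_cons zval_nil.
- by rewrite /phi zeck_zval ?zval_rcons_false // /canonical sw.
rewrite sorted_false in sw.
by rewrite rcons_cons !zval_cons !mul0n !add0n IH.
Qed.

Lemma zval_rconsE w b : sorted nonadj w -> zval (rcons w b) = phi (zval w) + b.
Proof. by move=> sw; rewrite zval_rcons phiE. Qed.

Lemma phi0 : phi 0 = 0.
Proof. by have := @phiE [::] isT; rewrite zval_cons zval_nil. Qed.

Lemma phi_eq0 n : (phi n == 0) = (n == 0).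
Proof.
apply/eqP/eqP => [e|->]; last exact: phi0.
by apply/eqP; rewrite -leqn0 -e phi_ge.
Qed.

Lemma zeck0 : zeck 0 = [::].
Proof. by rewrite -zval_nil (@zeck_zval [::]). Qed.

Lemma zeck_rcons n (b : bool) : (b ==> ~~ lastd n) -> (n != 0) || b ->
  zeck (phi n + b) = rcons (zeck n) b.
Proof.
move=> hb nz; rewrite -[n in phi n]zval_zeck -zval_rconsE ?zeck_sorted //.
rewrite zeck_zval // /canonical sorted_nonadj_rcons zeck_sorted /=.
apply/andP; split; first by case: (b) hb => //=; rewrite /nonadj andbC.
have /andP[_] := zeck_canonical n.
by case e: (zeck n) => //=; move: nz; rewrite -[n]zval_zeck e zval_nil.
Qed.

Lemma lastd_phi n (b : bool) : (b ==> ~~ lastd n) -> lastd (phi n + b) = b.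
Proof.
move=> hb; have [nz|] := boolP ((n != 0) || b).
  by rewrite /lastd zeck_rcons // last_rcons.
rewrite negb_or negbK => /andP[/eqP -> /negPf ->].
by rewrite (eqP (_ : phi 0 == 0)) ?phi_eq0 // /lastd zeck0.
Qed.

(** By the Fibonacci recurrence, the value with two zeros appended is the sum of those with one and
    with none; the digit [b] ends up at weight [zF 1], which is 2. *)
Lemma phi_phi n (b : bool) : (b ==> ~~ lastd n) ->
  phi (phi n + b) = phi n + n + b.*2.
Proof.
move=> hb; have sn := zeck_sorted n.
have sb : sorted nonadj (rcons (zeck n) b).
  by rewrite sorted_nonadj_rcons sn; case: (b) hb => //=; rewrite /nonadj andbC.
rewrite -{1}[n]zval_zeck -zval_rconsE // phiE //.
have -> : zval (rcons (rcons (zeck n) b) false)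
        = zval (rcons (rcons (zeck n) false) false) + b.*2.
  rewrite !zval_rcons_false !size_rcons !big_ord_recl /digit !rev_rcons /=.
  rewrite (_ : zF 1 = 2) //.
  by case: (b) => /=; rewrite ?mul0n ?mul1n ?add0n ?addn0 // addnC.
by rewrite zval_rcons_false2 -phiE // zval_zeck.
Qed.

(** * Splitting off the last digit, and the gaps of [phi] *)

Lemma phi_split n : exists k, n = phi k + lastd n /\ (lastd n ==> ~~ lastd k).
Proof.
case/lastP e: (zeck n) => [|w b].
  exists 0; rewrite /lastd e /= -[n]zval_zeck e zval_nil.
  by rewrite phi0.
have := zeck_sorted n; rewrite e sorted_nonadj_rcons => /andP[sw nb].
exists (zval w); rewrite /lastd e last_rcons -zval_rconsE // -e zval_zeck.
split=> //; case: (b) e nb => //= e nb.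
have /andP[_] := zeck_canonical n; rewrite e => hw.
have cw : canonical w by rewrite /canonical sw; case: (w) hw.
by rewrite zeck_zval //; move: nb; rewrite /nonadj andbT.
Qed.

(** Strong induction through the parent [k] with [n = phi k + lastd n]. If [n] or [k] ends in 1,
    then [n.+1 = phi k.+1]; otherwise [n.+1 = phi k + 1]. In each case [phi_phi] evaluates both
    sides. *)
Lemma phiS n : phi n.+1 = phi n + 2 - lastd n.
Proof.
have [m] := ubnP n; elim: m n => // m IH n nm.
have [k [en hk]] := phi_split n.
case l: (lastd n) en hk => /= en hk.
  have kn : k < m by have := phi_ge k; lia.
  have eS : n.+1 = phi k.+1 + false by rewrite IH // (negPf hk); lia.
  rewrite eS phi_phi // -(addn0 (phi k.+1)) -eS.
  by have := @phi_phi k true hk; rewrite -en /=; lia.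
have pn : phi n = phi k + k by have := @phi_phi k false isT; rewrite -en /=; lia.
case lk: (lastd k).
  have k0 : k != 0 by apply: contraTneq lk => ->; rewrite /lastd zeck0.
  have kn : k < m.
    have [kk' [ek hk']] := phi_split k; rewrite lk in ek.
    (* The inequality is strict: [k = phi k] would make [k] end in 0. *)
    have := phi_ge k.
    rewrite leq_eqVlt => /orP[/eqP ekk|]; last lia.
    by have := @lastd_phi k false isT; rewrite addn0 -ekk lk.
  have eS : n.+1 = phi k.+1 + false by rewrite IH // lk; lia.
  rewrite eS phi_phi // -(addn0 (phi k.+1)) -eS; lia.
have -> : n.+1 = phi k + true by lia.
rewrite phi_phi ?lk //=; lia.
Qed.

Lemma lastdS n : lastd n -> lastd n.+1 = false.
Proof.
move=> l; have [k [en hk]] := phi_split n; rewrite l /= in en hk.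
have -> : n.+1 = phi k.+1 + false by rewrite phiS (negPf hk); lia.
exact: lastd_phi.
Qed.

Lemma phi_ltS n (b : bool) : (b ==> ~~ lastd n) -> phi n + b < phi n.+1.
Proof. by rewrite phiS; case: (b) (lastd n) => [] [] //= _; lia. Qed.

Lemma ltn_phi : {homo phi : m n / m < n}.
Proof.
apply: homo_ltn => [k m n|n]; first exact: ltn_trans.
by have := @phi_ltS n false isT; rewrite addn0.
Qed.

Lemma leq_phi : {mono phi : m n / m <= n}.
Proof. exact: leq_mono ltn_phi. Qed.

Lemma phi_inj : injective phi.
Proof. exact: incn_inj leq_phi. Qed.

Lemma phi_split_uniq k l (a b : bool) : (a ==> ~~ lastd k) ->
  (b ==> ~~ lastd l) -> phi k + a = phi l + b -> k = l /\ a = b.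
Proof.
move=> ha hb e; have ab : a = b by rewrite -(lastd_phi ha) e lastd_phi.
by split=> //; apply: phi_inj; move: e; rewrite ab => /addIn.
Qed.

(* Two consecutive gaps of [phi] add up to at least 3. *)
Lemma phi_gap k c : phi k + c + c./2 <= phi (k + c).
Proof.
have [n] := ubnP c; elim: n c => // n IH [|[|c]] cn; first by rewrite !addn0.
  by have := @phi_ltS k false isT; rewrite !addn1 !addn0.
have := IH c (ltnW cn); rewrite -[c.+2./2]/(c./2.+1); move: c./2 => h.
rewrite !addnS !phiS.
have := @lastdS (k + c); case: (lastd (k + c)) => [->|_] //=; first lia.
by case: (lastd _) => /=; lia.
Qed.

(** * Windows of last digits and their evolution *)

(* [None] stands for the negative numbers among [v, v - 1, ..., v - C]. *)
Definition window (C v : nat) : {ffun 'I_C.+1 -> option bool} :=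
  [ffun c : 'I_C.+1 => if c <= v then Some (lastd (v - c)) else None].

(* [phi v - phi (v - c)], read off the window of [v]. *)
Definition gapsum C (s : {ffun 'I_C.+1 -> option bool}) (c : nat) : nat :=
  \sum_(j < C.+1 | 0 < j <= c) (2 - (s j == Some true)).

(* [phi v + b - c = phi (v - c') + a], in terms of the window of [v]. *)
Definition descends C (s : {ffun 'I_C.+1 -> option bool}) (b : bool) (c : nat)
    (c' : 'I_C.+1) (a : bool) : bool :=
  (c + a == b + gapsum s c')
  && (if a then s c' == Some false else s c' != None).

Lemma gapsum_window C v c : c <= C -> c <= v ->
  phi v = phi (v - c) + gapsum (window C v) c.
Proof.
elim: c => [|c IH] cC cv.
  rewrite subn0 /gapsum big1 ?addn0 // => j.
  by case: (nat_of_ord j).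
have -> : gapsum (window C v) c.+1
        = gapsum (window C v) c + (2 - lastd (v - c.+1)).
  rewrite /gapsum (bigD1 (Ordinal (cC : c.+1 < C.+1))) //= addnC.
  rewrite /window ffunE /= cv; congr (_ + (2 - _)); last by case: (lastd _).
  by apply: eq_bigl => j; rewrite -val_eqE /=; lia.
rewrite (IH (ltnW cC) (ltnW cv)).
have -> : v - c = (v - c.+1).+1 by lia.
by rewrite phiS; case: (lastd _) => /=; lia.
Qed.

(** The gaps in [gapsum] telescope to [phi v - phi (v - c')]. As [descends] compares sums, the
    truncated subtraction is guarded by [c <= phi v + b]. *)
Lemma descendsE C v (b : bool) c (c' : 'I_C.+1) (a : bool) :
  descends (window C v) b c c' a
  = [&& c' <= v, a ==> ~~ lastd (v - c'), c <= phi v + b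
      & phi v + b - c == phi (v - c') + a].
Proof.
rewrite /descends ffunE; case: (leqP c' v) => cv /=; last first.
  by case: a; rewrite andbF.
have := gapsum_window (ltn_ord c' : c' <= C) cv.
move: (gapsum _ _) (phi (v - c')) (nat_of_bool b) => G m n ->.
have -> : (if a then Some (lastd (v - c')) == Some false
           else Some (lastd (v - c')) != None) = (a ==> ~~ lastd (v - c')).
  by case: a (lastd _) => [] [].
rewrite andbC; congr (_ && _); apply/eqP/andP => [e|[le /eqP e]]; last by lia.
by split; [|apply/eqP]; lia.
Qed.

(** If the parent [k] of [phi v + b - c] had [v - k > C], then [phi_gap] would give
    [phi v - phi k >= C.+1 + C.+1./2], but this difference is at most [c + 1 <= C + C./2]. *)
Lemma descends_ex C v (b : bool) c : (b ==> ~~ lastd v) -> c < C + C./2 ->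
  c <= phi v + b -> exists (c' : 'I_C.+1) a, descends (window C v) b c c' a.
Proof.
move=> hb cC cv; have [k [ek hk]] := phi_split (phi v + b - c).
have kv : k <= v.
  rewrite -ltnS ltnNge -leq_phi -ltnNge; apply: leq_ltn_trans (phi_ltS hb).
  lia.
have c'C : v - k < C.+1.
  rewrite ltnNge; apply/negP => Ck.
  have := phi_gap k (v - k); rewrite subnKC //.
  have := half_leq Ck; rewrite -uphalfE; have := uphalf_half C.
  have : lastd (phi v + b - c) <= 1 by case: (lastd _).
  lia.
exists (Ordinal c'C), (lastd (phi v + b - c)).
by rewrite descendsE /= subKn // leq_subr hk cv -ek eqxx.
Qed.

(** In any descending pair [(c', a)], [a] is the last digit of [phi v + b - c]; if [c > phi v + b]
    there is no pair and the entry is [None]. *)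
Definition next_window C (s : {ffun 'I_C.+1 -> option bool}) (b : bool) :
    {ffun 'I_C.+1 -> option bool} :=
  [ffun c : 'I_C.+1 =>
    omap snd [pick ca : 'I_C.+1 * bool | descends s b c ca.1 ca.2]].

Lemma window_phi C v (b : bool) : 1 < C -> (b ==> ~~ lastd v) ->
  window C (phi v + b) = next_window (window C v) b.
Proof.
move=> C1 hb; apply/ffunP => c; rewrite [LHS]ffunE [RHS]ffunE.
case: pickP => [[c' a] /=|none] /=.
  rewrite descendsE => /and4P[_ ha -> /eqP ->].
  by rewrite lastd_phi.
(* [1 < C] puts every [c <= C] below [C + C./2]. *)
case: ifP => // cv; have cC : c < C + C./2.
  by apply: (leq_trans (ltn_ord c)); have := half_leq C1; rewrite /=; lia.
have [c' [a ca]] := descends_ex hb cC cv.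
by have := none (c', a); rewrite /= ca.
Qed.

Local Open Scope ring_scope.

(** * Weighted automata as linear representations *)

Definition wstep (R : comPzRingType) (B : Type) (S : finType)
    (D : S -> B -> S -> R) (u : S -> R) (b : B) : S -> R :=
  fun q => \sum_p u p * D p b q.

(** A path for [b :: w] is a first state followed by a path for [w]; summing over the first state
    turns the first transition into a new initial vector. *)
Lemma weight_cons (R : comPzRingType) (B : Type) (S : finType)
    (D : S -> B -> S -> R) (I F : S -> R) (b : B) (w : seq B) :
  weight (WeightedAutomaton D I F) (b :: w)
  = weight (WeightedAutomaton D (wstep D I b) F) w.
Proof.
pose cons_ffun (qp : S * {ffun 'I_(size w).+1 -> S}) : {ffun 'I_(size w).+2 -> S} :=
  [ffun i => if unlift ord0 i is Some j then qp.2 j else qp.1].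
have cons_bij : bijective cons_ffun.
  exists (fun p : {ffun 'I_(size w).+2 -> S} =>
           (p ord0, [ffun j => p (lift ord0 j)])) => [[q p]|p].
    congr (_, _); first by rewrite ffunE unlift_none.
    by apply/ffunP => j; rewrite !ffunE liftK.
  by apply/ffunP => i; rewrite ffunE; case: unliftP => [j|] -> //=; rewrite ffunE.
rewrite /weight (reindex cons_ffun) /=; last exact: onW_bij.
pose A := WeightedAutomaton D I F.
rewrite -(pair_big xpredT xpredT
            (fun q p => @path_weight R B A (b :: w) (cons_ffun (q, p)))) /=.
rewrite exchange_big; apply: eq_bigr => p _.
rewrite /path_weight /= /wstep !big_distrl /=; apply: eq_bigr => q _.
have c0 : cons_ffun (q, p) ord0 = q by rewrite ffunE unlift_none.
have cS j : cons_ffun (q, p) (lift ord0 j) = p j by rewrite ffunE liftK.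
rewrite big_ord_recl c0 cS.
rewrite (_ : cons_ffun (q, p) (widen_ord _ ord0) = q); last first.
  by apply: etrans c0; congr (cons_ffun _ _); apply: val_inj.
rewrite (_ : cons_ffun (q, p) ord_max = p ord_max); last first.
  by rewrite -cS; congr (cons_ffun _ _); apply: val_inj.
rewrite (_ : tnth _ ord0 = b) // !mulrA; congr (_ * _ * _).
apply: eq_bigr => i _; congr D.
- by rewrite -cS; congr (cons_ffun _ _); apply: val_inj.
- by rewrite !(tnth_nth b).
by rewrite -cS.
Qed.

Lemma weightE (R : comPzRingType) (B : Type) (S : finType)
    (D : S -> B -> S -> R) (I F : S -> R) (w : seq B) :
  weight (WeightedAutomaton D I F) w = \sum_q foldl (wstep D) I w q * F q.
Proof.
elim: w I => [|b w IH] I; last by rewrite weight_cons IH.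
rewrite /weight (reindex (fun q : S => [ffun=> q] : {ffun 'I_1 -> S})) /=.
  by apply: eq_bigr => q _; rewrite /path_weight big_ord0 !ffunE mulr1.
exists (fun p => p ord0) => [q _|p _]; first by rewrite ffunE.
by apply/ffunP => i; rewrite ffunE (ord1 i).
Qed.

(* Unlike a weighted automaton, such a family also has to be compatible with
   a leading digit 0, by the case [n = 0], [b = false]. *)
Definition linear_rep (R : comPzRingType) (X : finType) (u : X -> series R)
    (T : X -> bool -> X -> R) : Prop :=
  forall n b x, (b ==> ~~ lastd n) ->
    u x (phi n + b)%N = \sum_y u y n * T y b x.

(** With initial vector [u x 0], the state vector after each prefix of the expansion consists of the
    values of [u] at that prefix. *)
Lemma Z_regular_linear_rep (R : comPzRingType) (f : series R) (X : finType)
    (u : X -> series R) (T : X -> bool -> X -> R) (c : X -> R) :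
  linear_rep u T -> (forall n, f n = \sum_x u x n * c x) -> Z_regular f.
Proof.
move=> uT fE; exists (WeightedAutomaton T (u^~ 0%N) c) => n.
rewrite fE weightE; apply: eq_bigr => x _; congr (_ * _).
rewrite -{1}[n]zval_zeck; have := zeck_sorted n.
elim/last_ind: (zeck n) x => [|w b IH] x; first by rewrite zval_nil.
rewrite sorted_nonadj_rcons => /andP[sw nb].
rewrite zval_rconsE // foldl_rcons uT; last first.
  apply/implyP => bT; move: nb; rewrite bT /nonadj andbT.
  (* A prefix whose value ends in 1 itself ends in 1; the induction strips leading zeros. *)
  apply: contra; elim: {IH} w sw => [|[] w IH] sw; first by rewrite /lastd zval_nil zeck0.
    by rewrite /lastd zeck_zval // /canonical sw.
  rewrite sorted_false in sw; rewrite zval_cons mul0n add0n => /(IH sw).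
  by case: (w).
by apply: eq_bigr => y _; rewrite IH.
Qed.

Lemma linear_rep_Z_regular (R : comPzRingType) (f : series R) : Z_regular f ->
  exists (X : finType) (u : X -> series R) (T : X -> bool -> X -> R)
    (c : X -> R), linear_rep u T /\ forall n, f n = \sum_x u x n * c x.
Proof.
case=> -[S D I F] fE; pose v n := foldl (wstep D) I (zeck n).
(* [None] is an initial state on which leading zeros loop. *)
pose u (x : option S) n := if x is Some q then if n == 0%N then 0 else v n q
                           else (n == 0%N)%:R : R.
pose T (x : option S) (b : bool) (y : option S) := match x, y with
  | Some p, Some q => D p b q
  | None, Some q => if b then wstep D I true q else 0
  | None, None => (~~ b)%:R
  | Some _, None => 0 end.
(* Since [zeck 0] is empty, [None] outputs the weight of the empty word. *)
pose c x := if x is Some q then F q else \sum_q I q * F q.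
have optE (h : option S -> R) : \sum_x h x = h None + \sum_q h (Some q).
  rewrite (bigD1 None) //= (reindex_omap Some id) /=; last by case.
  by congr (_ + _); apply: eq_bigl => q; rewrite eqxx.
exists (option S), u, T, c; split=> [n b x hb|n]; last first.
  rewrite fE weightE optE /=; have [->|n0] := eqVneq n 0%N.
    rewrite mul1r zeck0 [X in _ + X]big1 ?addr0 //= => q _; exact: mul0r.
  by rewrite mul0r add0r.
rewrite optE; case: x => [q|] /=; last first.
  rewrite [X in _ + X]big1 ?addr0 => [|q _]; last by rewrite mulr0.
  by rewrite addn_eq0 phi_eq0 -natrM mulnb eqb0.
rewrite addn_eq0 phi_eq0 eqb0 /v.
have [n0|n0] := eqVneq n 0%N; last first.
  by rewrite mul0r add0r /= zeck_rcons ?n0 // foldl_rcons.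
rewrite big1 ?addr0 => [|p _]; last by rewrite mul0r.
rewrite mul1r; case: b hb => hb; last by [].
by rewrite andbF zeck_rcons ?orbT // foldl_rcons n0 zeck0.
Qed.

(** * Coefficients of [x^c h(x)] and linear forms depending on the window *)

Definition shift (R : comPzRingType) (h : series R) (n c : nat) : R :=
  if (c <= n)%N then h (n - c)%N else 0.

(** If [c <= phi v + b], exactly one pair descends, by [descends_ex] and [phi_split_uniq]; otherwise
    none does and both sides are 0. *)
Lemma shift_phi (R : comPzRingType) (h : series R) C v (b : bool) c :
  (b ==> ~~ lastd v) -> (c < C + C./2)%N ->
  shift h (phi v + b)%N c
  = \sum_(c' < C.+1) \sum_a
      (descends (window C v) b c c' a)%:R * h (phi (v - c') + a)%N.
Proof.
move=> hb cC; rewrite pair_bigA /= /shift; case: ifP => cv; last first.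
  by rewrite big1 // => -[c' a] _; rewrite descendsE cv /= !andbF mul0r.
have [c1 [a1 D1]] := descends_ex hb cC cv.
rewrite (bigD1 (c1, a1)) //= D1 mul1r [X in _ + X]big1 ?addr0.
  by move: D1; rewrite descendsE => /and4P[_ _ _ /eqP ->].
move=> [c2 a2] /= ne; case D2: (descends _ _ _ _ _); last by rewrite mul0r.
case/eqP: ne; move: D1 D2; rewrite !descendsE.
move=> /and4P[v1 h1 _ /eqP e1] /and4P[v2 h2 _ /eqP e2].
have [ek ->] := phi_split_uniq h2 h1 (etrans (esym e2) e1).
by congr (_, _); apply: val_inj => /=; lia.
Qed.

(** The coefficients depend on [v] only through its window, which takes finitely many values and so
    fits into a state. *)
Definition window_linear (R : comPzRingType) (J : finType) (u : J -> series R)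
    (C : nat) (t : nat -> bool -> R) : Prop :=
  exists k : {ffun 'I_C.+1 -> option bool} -> bool -> J * 'I_C.+1 -> R,
  forall v b, (b ==> ~~ lastd v) ->
    t v b = \sum_(x : J * 'I_C.+1) shift (u x.1) v x.2 * k (window C v) b x.

Lemma window_linearD (R : comPzRingType) (J : finType) (u : J -> series R)
    (C : nat) (t1 t2 : nat -> bool -> R) :
  window_linear u C t1 -> window_linear u C t2 ->
  window_linear u C (fun v b => t1 v b + t2 v b).
Proof.
move=> [k1 e1] [k2 e2]; exists (fun s b x => k1 s b x + k2 s b x) => v b hb.
by rewrite e1 // e2 // -big_split; apply: eq_bigr => x _; rewrite mulrDr.
Qed.

Lemma window_linearZ (R : comPzRingType) (J : finType) (u : J -> series R)
    (C : nat) (a : R) (t : nat -> bool -> R) :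
  window_linear u C t -> window_linear u C (fun v b => a * t v b).
Proof.
move=> [k e]; exists (fun s b x => a * k s b x) => v b hb.
by rewrite e // big_distrr; apply: eq_bigr => x _; rewrite mulrCA.
Qed.

Lemma window_linear_sum (R : comPzRingType) (J I : finType) (u : J -> series R)
    (C : nat) (t : I -> nat -> bool -> R) :
  (forall i, window_linear u C (t i)) ->
  window_linear u C (fun v b => \sum_i t i v b).
Proof.
move=> /fin_all_exists[k e]; exists (fun s b x => \sum_i k i s b x) => v b hb.
under [RHS]eq_bigr do rewrite big_distrr.
by rewrite exchange_big; apply: eq_bigr => i _; rewrite e.
Qed.

Lemma eq_window_linear (R : comPzRingType) (J : finType) (u : J -> series R)
    (C : nat) (t1 t2 : nat -> bool -> R) :
  (forall v b, t1 v b = t2 v b) ->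
  window_linear u C t1 -> window_linear u C t2.
Proof. by move=> e [k ek]; exists k => v b hb; rewrite -e ek. Qed.

Lemma window_linear_shift (R : comPzRingType) (J : finType) (u : J -> series R)
    (C c : nat) (h : series R) (T : bool -> J -> R) : (c < C + C./2)%N ->
  (forall v b, (b ==> ~~ lastd v) ->
     h (phi v + b)%N = \sum_j u j v * T b j) ->
  window_linear u C (fun v b => shift h (phi v + b)%N c).
Proof.
move=> cC hT.
exists (fun s b x => \sum_a (descends s b c x.2 a)%:R * T a x.1) => v b hb.
rewrite (shift_phi _ hb cC).
rewrite -(pair_bigA _ (fun j (c' : 'I_C.+1) => shift (u j) v c' *
   \sum_a (descends (window C v) b c c' a)%:R * T a j)) /= [RHS]exchange_big /=.
apply: eq_bigr => c' _; under [RHS]eq_bigr do rewrite big_distrr.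
rewrite [RHS]exchange_big; apply: eq_bigr => a _ /=.
case D: (descends _ _ _ _ _); last first.
  by rewrite mul0r big1 // => j _; rewrite mul0r mulr0.
move: D; rewrite descendsE => /and4P[cv ha _ _].
rewrite mul1r hT //; apply: eq_bigr => j _.
by rewrite mul1r /shift cv.
Qed.

(** A state pairs a candidate window with an entry; its value at [v] is the entry if the window is
    that of [v], and 0 otherwise. The transition coefficients thus depend on states and digit
    alone. *)
Lemma window_linear_regular (R : comPzRingType) (J : finType)
    (u : J -> series R) (C : nat) : (1 < C)%N ->
  (forall x : J * 'I_C.+1,
     window_linear u C (fun v b => shift (u x.1) (phi v + b)%N x.2)) ->
  forall j, Z_regular (u j).
Proof.
move=> C1 /fin_all_exists[k ek] j.
pose U (y : {ffun 'I_C.+1 -> option bool} * (J * 'I_C.+1)) : series R :=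
  fun v => (window C v == y.1)%:R * shift (u y.2.1) v y.2.2.
pose T (y : {ffun 'I_C.+1 -> option bool} * (J * 'I_C.+1)) (b : bool)
       (z : {ffun 'I_C.+1 -> option bool} * (J * 'I_C.+1)) : R :=
  (next_window y.1 b == z.1)%:R * k z.2 y.1 b y.2.
have sumU v (F : {ffun 'I_C.+1 -> option bool} * (J * 'I_C.+1) -> R) :
    \sum_y U y v * F y = \sum_(x : J * 'I_C.+1) shift (u x.1) v x.2 * F (window C v, x).
  transitivity (\sum_s \sum_x U (s, x) v * F (s, x)).
    by rewrite pair_bigA; apply: eq_bigr => -[].
  rewrite (bigD1 (window C v)) //= [X in _ + X]big1 ?addr0.
    by apply: eq_bigr => x _; rewrite /U eqxx mul1r.
  move=> s ne; rewrite big1 // => x _.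
  by rewrite /U eq_sym (negPf ne) !mul0r.
apply: (@Z_regular_linear_rep R (u j) _ U T (fun y => (y.2 == (j, ord0))%:R)).
  move=> v b [s x] hb; rewrite sumU {1}/U /= ek // big_distrr.
  apply: eq_bigr => y _; rewrite /T /= window_phi //.
  by rewrite !mulrA (mulrC (shift _ _ _)).
move=> n; rewrite sumU (bigD1 (j, ord0)) //= eqxx mulr1 big1 ?addr0.
  by rewrite /shift subn0.
by move=> x /negPf ->; rewrite mulr0.
Qed.

(** * The Z-Mahler operator and the isolating equation *)

Lemma Phi_phi (R : comPzRingType) (h : series R) k (a : bool) :
  (a ==> ~~ lastd k) -> Phi h (phi k + a)%N = if a then 0 else h k.
Proof.
move=> ha; have split_eq n : (phi n == phi k + a)%N -> n = k /\ a = false.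
  rewrite -(addn0 (phi n)) => /eqP e.
  by have [-> <-] := @phi_split_uniq n k false a isT ha e.
rewrite /Phi; case: a ha split_eq => ha split_eq.
  by rewrite big1 // => n /split_eq[].
have kk : (k < (phi k + false).+1)%N by rewrite addn0 ltnS phi_ge.
rewrite (big_pred1 (Ordinal kk)) // => n.
apply/idP/eqP => [/split_eq[e _]|->]; first exact: val_inj.
by rewrite /= addn0.
Qed.

Lemma shift_mul (R : comPzRingType) (a h : series R) (L n c : nat) :
  (forall l, (L <= l)%N -> a l = 0) ->
  shift (series_mul a h) n c = \sum_(l < L) a l * shift h n (c + l)%N.
Proof.
move=> a0; rewrite /shift /series_mul; case: ifP => cn; last first.
  rewrite big1 // => l _; rewrite ifF ?mulr0 //.
  by apply: contraFF cn; apply: leq_trans (leq_addr _ _).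
(* Both sides truncate one sum of [F]: terms with [l > n - c] vanish by the test in [F], those with
   [l >= L] by [a0]. *)
pose F l := if (c + l <= n)%N then a l * h (n - (c + l))%N else 0.
transitivity (\sum_(l < maxn L (n - c).+1) F l).
  rewrite -(big_mkord xpredT F) (big_cat_nat (n := (n - c).+1)) ?leq_maxr //=.
  rewrite [X in _ + X]big1_seq ?addr0 => [|l].
    rewrite big_mkord; apply: eq_bigr => l _; rewrite /F ifT ?subnDA //.
    by have := ltn_ord l; lia.
  by rewrite mem_index_iota /F => ?; rewrite ifF //; lia.
rewrite -(big_mkord xpredT F) (big_cat_nat (n := L)) ?leq_maxl //=.
rewrite [X in _ + X]big1_seq ?addr0 => [|l].
  by rewrite big_mkord; apply: eq_bigr => l _; rewrite /F; case: ifP; rewrite ?mulr0.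
by rewrite mem_index_iota /F => /andP[_ /andP[Ll _]]; rewrite a0 // mul0r if_same.
Qed.

Theorem theorem35 (R : comPzRingType) (d : nat)
    (A : nat -> series R) (f g : series R)
    (A_poly : forall i : nat, (1 <= i <= d)%N -> is_polynomial (A i))
    (g_reg : Z_regular g)
    (f_eq : forall n : nat,
       f n = \sum_(1 <= i < d.+1) series_mul (A i) (iter i (@Phi R) f) n + g n) :
  Z_regular f.
Proof.
have /fin_all_exists[N AN] (i : 'I_d) : is_polynomial (A i.+1).
  by apply: A_poly; rewrite /= ltn_ord.
(* Since [C./2 = L.+1], all [c + l] with [c <= C] and [l < L] lie below [C + C./2]. *)
pose L := \max_i N i; pose C := L.+1.*2.
have A0 (i : 'I_d) l : (L <= l)%N -> A i.+1 l = 0.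
  by move=> Ll; apply: AN; apply: leq_trans Ll; apply: leq_bigmax.
have [Y [V [T [G [VT gE]]]]] := linear_rep_Z_regular g_reg.
pose u (j : 'I_d.+1 + Y) : series R :=
  match j with inl i => iter i (@Phi R) f | inr y => V y end.
have C2 : (C./2 = L.+1)%N by rewrite /C doubleK.
have wV y c : (c < C + C./2)%N ->
    window_linear u C (fun v b => shift (V y) (phi v + b)%N c).
  move=> cC; pose Ty b (j : 'I_d.+1 + Y) := if j is inr z then T z b y else 0.
  apply: (window_linear_shift (T := Ty)) => // v b hb.
  rewrite VT // big_sumType /= [X in X + _]big1 ?add0r //.
  by move=> i _; rewrite mulr0.
have wPhi (i : 'I_d) c : (c < C + C./2)%N ->
    window_linear u C (fun v b => shift (iter i.+1 (@Phi R) f) (phi v + b)%N c).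
  move=> cC; pose j0 : 'I_d.+1 + Y := inl (widen_ord (leqnSn d) i).
  apply: (window_linear_shift (T := fun b j => (~~ b && (j == j0))%:R)) => //.
  move=> v b hb; rewrite iterS Phi_phi // (bigD1 j0) //= eqxx andbT.
  rewrite big1 ?addr0; first by case: (b); rewrite ?mulr0 ?mulr1.
  by move=> j /negPf ->; rewrite andbF mulr0.
suff wu (x : ('I_d.+1 + Y) * 'I_C.+1) :
    window_linear u C (fun v b => shift (u x.1) (phi v + b)%N x.2).
  exact: (window_linear_regular (C := C) isT wu (inl ord0)).
have xC c : (c < C.+1)%N -> (c < C + C./2)%N by rewrite C2; lia.
case: x => -[[[|i] lt_i]|y] c /=; last exact/wV/xC/ltn_ord; last first.
  exact: (wPhi (Ordinal (lt_i : (i < d)%N)) _ (xC _ (ltn_ord c))).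
(* For [f] itself, the equation trades its value for those of [Phi^i f] with [i >= 1], covered by
   [wPhi], and of [g], covered by [wV]. *)
apply: (@eq_window_linear _ _ _ _ (fun v b =>
    \sum_(i < d) \sum_(l < L)
      A i.+1 l * shift (iter i.+1 (@Phi R) f) (phi v + b)%N (c + l)%N
    + \sum_y G y * shift (V y) (phi v + b)%N c)).
  move=> v b; move: (phi v + b)%N => n.
  under eq_bigr => i _ do rewrite -(shift_mul _ _ _ (A0 i)).
  rewrite /shift; case: ifP => cn; last first.
    by rewrite !big1 ?addr0 // => y _; rewrite mulr0.
  rewrite f_eq gE big_add1 big_mkord; congr (_ + _).
  by apply: eq_bigr => y _; rewrite mulrC.
apply: window_linearD; apply: window_linear_sum => i; last first.
  exact/window_linearZ/wV/xC/ltn_ord.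
apply: window_linear_sum => l; apply/window_linearZ/wPhi.
by rewrite C2; have := ltn_ord c; have := ltn_ord l; lia.
Qed.
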